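(* Let $(\Omega,\mathcal F,\mathbb P)$ be an atomless probability space, let $X$ and $Y$ be continuously distributed integrable random variables on it, and let $p\in(0,1)$. Then: (i) If $X$ and $Y$ are weakly comonotonic with respect to $\mathcal P^X_p$, and $X$ and $Y$ are weakly antimonotonic with respect to $\mathcal Q^X_p$, then $(X,Y)$ maximizes the $\mathrm{VaR}_p$ aggregation, i.e. $\mathrm{VaR}_p(X+Y)=\max\{\mathrm{VaR}_p(X'+Y'): X'\overset{d}{=}X,\ Y'\overset{d}{=}Y\}$. (ii) $X$ and $Y$ are weakly comonotonic with respect to $\mathcal P^X_p$ if and only if $(X,Y)$ maximizes the $\mathrm{ES}_p$ aggregation, i.e. $\mathrm{ES}_p(X+Y)=\max\{\mathrm{ES}_p(X'+Y'): X'\overset{d}{=}X,\ Y'\overset{d}{=}Y\}$.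
   Context: In the maxima, $X',Y'$ range over random variables on $(\Omega,\mathcal F,\mathbb P)$ and $\overset{d}{=}$ denotes equality in distribution. For a random variable $Z$ and $q\in(0,1)$, $\mathrm{VaR}_q(Z)=\inf\{x\in\mathbb R:\mathbb P(Z\le x)>q\}$ and $\mathrm{ES}_q(Z)=\frac1{1-q}\int_q^1\mathrm{VaR}_r(Z)\,\mathrm dr$. Let $A^Z_p=\{\omega: Z(\omega)>\mathrm{VaR}_p(Z)\}$, $\mathcal P^Z_p=\{\delta_\omega\times\delta_{\omega'}:\omega\in A^Z_p,\ \omega'\in(A^Z_p)^c\}$ and $\mathcal Q^Z_p=\{\delta_\omega\times\delta_{\omega'}:\omega,\omega'\in A^Z_p\}$, where $\delta_\omega$ is the point mass at $\omega$. For a set $\mathcal P$ of product probability measures $\pi_1\times\pi_2$ on $(\Omega^2,\mathcal F\otimes\mathcal F)$, $X,Y$ are weakly comonotonic (resp. weakly antimonotonic) with respect to $\mathcal P$ if $\iint_{\Omega^2}(X(\omega)-X(\omega'))(Y(\omega)-Y(\omega'))\,\pi_1(\mathrm d\omega)\pi_2(\mathrm d\omega')\ge0$ (resp. $\le 0$) for every $\pi_1\times\pi_2\in\mathcal P$; for point masses $\delta_\omega\times\delta_{\omega'}$ the integral is $(X(\omega)-X(\omega'))(Y(\omega)-Y(\omega'))$. Random variables that are a.s. equal are identified, so such conditions are understood to hold for some representative versions of $X$ and $Y$. *)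

(* Defs.v *)
From HB Require Import structures.
From mathcomp Require Import all_boot all_order all_algebra.
From mathcomp Require Import all_classical all_reals all_analysis.
Set Implicit Arguments. Unset Strict Implicit. Unset Printing Implicit Defensive.
Import Order.TTheory GRing.Theory Num.Theory.
Import numFieldNormedType.Exports.
Local Open Scope classical_set_scope.
Local Open Scope ring_scope.

Section Defs.
Context {d : measure_display} {T : measurableType d} {R : realType}.
Variable P : probability T R.

Definition atomless : Prop :=
  forall A : set T, measurable A -> (0 < P A)%E ->
    exists B : set T, [/\ measurable B, B `<=` A, (0 < P B)%E & (P B < P A)%E].

Definition cont_distributed (X : T -> R) : Prop :=
  forall x : R, P [set w | X w = x] = 0%E.

Definition eq_dist (X X' : T -> R) : Prop :=
  forall B : set R, measurable B -> P (X @^-1` B) = P (X' @^-1` B).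

Definition VaR (q : R) (Z : T -> R) : R :=
  inf [set x : R | (q%:E < P [set w | (Z w <= x)%R])%E].

Definition ES (q : R) (Z : T -> R) : \bar R :=
  (((1 - q)^-1)%:E *
    \int[@lebesgue_measure R]_(r in `]q, 1%R[%classic) (VaR r Z)%:E)%E.

Definition Aset (p : R) (Z : T -> R) : set T := [set w | VaR p Z < Z w].

(* weakly comonotonic w.r.t. P^X_p (point masses delta_w x delta_w',
   w in A^X_p, w' not in A^X_p) *)
Definition wcomono_P (p : R) (X Y : T -> R) : Prop :=
  forall w w', Aset p X w -> ~ Aset p X w' ->
    0 <= (X w - X w') * (Y w - Y w').

Definition wantimono_Q (p : R) (X Y : T -> R) : Prop :=
  forall w w', Aset p X w -> Aset p X w' ->
    (X w - X w') * (Y w - Y w') <= 0.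

Definition versions (X Y X0 Y0 : T -> R) : Prop :=
  [/\ measurable_fun setT X0, measurable_fun setT Y0,
      {ae P, forall w, X0 w = X w} & {ae P, forall w, Y0 w = Y w}].

End Defs.

(* Main.v *)
(* Everything rests on [ru p Z c = (1 - p) c + E (Z - c)^+]. By the quantile
   transform, (1 - p) ES_p(Z) is the value of this objective at c = VaR_p(Z),
   and this value is its minimum over c (Rockafellar-Uryasev); the minimum is
   also attained at any s that separates the values of Z on some event of
   probability 1 - p from those off it. As ru p (X + Y) (a + b) <=
   ru p X a + ru p Y b, with equality when X - a and Y - b have the same sign,
   weak comonotonicity gives maximality. Conversely Y is compared with
   Y' = VaR_U(Y) for U = F_X(X): maximality of (X, Y) forces
   (X - a)^+ + (Y - b)^+ = (X + Y - a - b)^+ a.s. at a = VaR_p(X),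
   b = VaR_p(Y), so X - a and Y - b almost surely have the same sign.
   For VaR_p, if P(X > a) + P(Y > b) < 1 - p then VaR_p(X' + Y') <= a + b;
   antimonotonicity on the tail event makes {X > a} and {Y > b} disjoint
   there, which lets a + b approach VaR_p(X + Y). *)
Require Import Defs.
From HB Require Import structures.
From mathcomp Require Import all_boot all_order all_algebra.
From mathcomp Require Import all_classical all_reals all_analysis.
From mathcomp Require Import measurable_realfun lra.
Set Implicit Arguments.
Unset Strict Implicit.
Unset Printing Implicit Defensive.
Import Order.TTheory GRing.Theory Num.Theory.
Import numFieldNormedType.Exports.
Local Open Scope classical_set_scope.
Local Open Scope ring_scope.

(** * Distribution functions and upper quantiles *)

Section Distribution.
Context {d : measure_display} {T : measurableType d} {R : realType}.
Variable P : probability T R.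
Implicit Types (X Y Z : T -> R) (x q : R) (B : set R).

Lemma measurable_preimage Z B :
  measurable_fun setT Z -> measurable B -> measurable (Z @^-1` B).
Proof. by move=> mZ mB; rewrite -[X in measurable X]setTI; exact: mZ. Qed.

Lemma set_leE Z x : [set w | Z w <= x] = Z @^-1` `]-oo, x].
Proof. by apply/seteqP; split=> w /=; rewrite in_itv. Qed.

Lemma measurable_set_le Z x : measurable_fun setT Z ->
  measurable [set w | Z w <= x].
Proof. by move=> mZ; rewrite set_leE; exact: measurable_preimage. Qed.

Lemma measurable_set_gt Z x : measurable_fun setT Z ->
  measurable [set w | x < Z w].
Proof.
move=> mZ; rewrite (_ : mkset _ = Z @^-1` `]x, +oo[).
  exact: measurable_preimage.
by apply/seteqP; split=> w /=; rewrite in_itv/= andbT.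
Qed.

Lemma fine_probability_setC (A : set T) : measurable A ->
  fine (P (~` A)) = 1 - fine (P A).
Proof. by move=> mA; rewrite probability_setC// fineB ?fin_num_measure. Qed.

Lemma le_fine_measure (A B : set T) : measurable A -> measurable B ->
  A `<=` B -> fine (P A) <= fine (P B).
Proof.
by move=> mA mB AB; rewrite fine_le ?fin_num_measure// le_measure ?inE.
Qed.

Lemma fine_probability_le1 (A : set T) : measurable A -> fine (P A) <= 1.
Proof. by move=> mA; rewrite -lee_fin fineK ?fin_num_measure ?probability_le1. Qed.

Lemma fine_measureU2 (A B : set T) : measurable A -> measurable B ->
  fine (P (A `|` B)) <= fine (P A) + fine (P B).
Proof.
move=> mA mB; rewrite -lee_fin EFinD !fineK ?fin_num_measure//.
  exact: measureU2.
exact: measurableU.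
Qed.

Lemma fine_measureU (A B : set T) : measurable A -> measurable B ->
  [disjoint A & B] -> fine (P (A `|` B)) = fine (P A) + fine (P B).
Proof.
by move=> mA mB /disj_set2P AB; rewrite measureU// fineD ?fin_num_measure//.
Qed.

Definition cumul Z x : R := fine (P [set w | Z w <= x]).

Lemma cumulE Z x : measurable_fun setT Z ->
  P [set w | Z w <= x] = (cumul Z x)%:E.
Proof.
by move=> mZ; rewrite /cumul fineK// fin_num_measure//; exact: measurable_set_le.
Qed.

Lemma cumul_ge0 Z x : 0 <= cumul Z x.
Proof. by rewrite fine_ge0. Qed.

Lemma cumul_le1 Z x : measurable_fun setT Z -> cumul Z x <= 1.
Proof. by move=> mZ; apply: fine_probability_le1; exact: measurable_set_le. Qed.

Lemma cumul_homo Z : measurable_fun setT Z -> nondecreasing_fun (cumul Z).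
Proof.
move=> mZ x y xy; apply: le_fine_measure; try exact: measurable_set_le.
by move=> w /= /le_trans; apply.
Qed.

Lemma cumul_cdf Z (mZ : measurable_fun setT Z) x :
  cumul Z x = fine (cdf (P := P) (mfun_Sub (mem_set mZ)) x).
Proof. by rewrite /cumul set_leE. Qed.

Lemma cumul_right_continuous Z x : measurable_fun setT Z ->
  cumul Z y @[y --> x^'+] --> cumul Z x.
Proof.
move=> mZ; under eq_fun do rewrite cumul_cdf.
rewrite cumul_cdf; apply: fine_cvg.
rewrite fineK; first exact: cdf_right_continuous.
by rewrite fin_num_measure.
Qed.

Lemma exists_cumul_lt Z q : measurable_fun setT Z -> 0 < q ->
  exists x, cumul Z x < q.
Proof.
move=> mZ q0.
have cvg0 : cumul Z x @[x --> -oo] --> (0 : R).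
  under eq_fun do rewrite cumul_cdf.
  by apply: fine_cvg; exact: cvg_cdfNy0.
have := cvgr_lt _ cvg0 _ q0; case=> M [_ HM].
by exists (M - 1); apply: HM; rewrite ltrBlDr ltrDl.
Qed.

Lemma exists_cumul_gt Z q : measurable_fun setT Z -> q < 1 ->
  exists x, q < cumul Z x.
Proof.
move=> mZ q1.
have cvg1 : cumul Z x @[x --> +oo] --> (1 : R).
  under eq_fun do rewrite cumul_cdf.
  by apply: fine_cvg; exact: cvg_cdfy1.
have := cvgr_gt _ cvg1 _ q1; case=> M [_ HM].
by exists (M + 1); apply: HM; rewrite ltrDl.
Qed.

Lemma VaRE q Z : measurable_fun setT Z ->
  VaR P q Z = inf [set x | q < cumul Z x].
Proof.
move=> mZ; congr inf; apply/seteqP.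
by split=> x /=; rewrite cumulE// lte_fin.
Qed.

(** Positivity of [q] bounds the set under the infimum from below, because [cumul Z] falls under [q]
    far to the left; without such a bound [inf] is a default value. *)
Lemma VaR_le q Z x : measurable_fun setT Z -> 0 < q ->
  q < cumul Z x -> VaR P q Z <= x.
Proof.
move=> mZ q0 qx; rewrite VaRE//; apply: ge_inf => //.
have [y yq] := exists_cumul_lt mZ q0; exists y => z /= qz.
rewrite leNgt; apply/negP => /ltW /(cumul_homo mZ) zy.
by have := lt_le_trans qz zy; rewrite ltNge (ltW yq).
Qed.

(** Here [q < 1] makes that set nonempty, so it has a point below [x], and monotonicity carries the
    strict bound up to [x]. *)
Lemma cumul_gt q Z x : measurable_fun setT Z -> q < 1 ->
  VaR P q Z < x -> q < cumul Z x.
Proof.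
move=> mZ q1; rewrite VaRE// => /inf_lt[|y qy yx].
  by have [y] := exists_cumul_gt mZ q1; exists y.
by rewrite (lt_le_trans qy)// cumul_homo// ltW.
Qed.

Lemma VaR_homo Z q r : measurable_fun setT Z -> 0 < q -> r < 1 -> q <= r ->
  VaR P q Z <= VaR P r Z.
Proof.
move=> mZ q0 r1 qr; apply/ler_addgt0Pr => e e0.
apply: VaR_le => //; rewrite (le_lt_trans qr)//.
by apply: cumul_gt; rewrite // ltrDl.
Qed.

Lemma cumul_VaR_ge q Z : measurable_fun setT Z -> q < 1 ->
  q <= cumul Z (VaR P q Z).
Proof.
move=> mZ q1; apply: (cvgr_to_ge (cumul_right_continuous (x := VaR P q Z) mZ)).
by near=> x; apply/ltW/cumul_gt.
Unshelve. all: by end_near. Qed.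

Lemma set_ltE Z x :
  [set w | Z w < x] = \bigcup_n [set w | Z w <= x - n.+1%:R^-1].
Proof.
apply/seteqP; split=> w /=.
  rewrite -subr_gt0 => /ltr_add_invr[n]; rewrite add0r => nx.
  by exists n => //=; rewrite lerBrDr -lerBrDl ltW.
by move=> [n _ /= /le_lt_trans]; apply; rewrite ltrBlDr ltrDl invr_gt0.
Qed.

(** Continuity from below along levels approaching the quantile; each such level has [cumul] at most
    [q] by [VaR_le]. *)
Lemma probability_lt_VaR q Z : measurable_fun setT Z -> 0 < q ->
  fine (P [set w | Z w < VaR P q Z]) <= q.
Proof.
move=> mZ q0; rewrite -lee_fin fineK; last first.
  rewrite fin_num_measure// set_ltE; apply: bigcup_measurable => n _.
  exact: measurable_set_le.
have cv : (P \o fun n => [set w | Z w <= VaR P q Z - n.+1%:R^-1]) n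
    @[n --> \oo] --> P [set w | Z w < VaR P q Z].
  rewrite set_ltE; apply: nondecreasing_cvg_mu.
  - by move=> n; exact: measurable_set_le.
  - by apply: bigcup_measurable => n _; exact: measurable_set_le.
  - move=> n m nm; apply/subsetPset => w /= /le_trans; apply.
    by rewrite lerD2l lerN2 lef_pV2 ?posrE// ler_nat.
apply: (cvge_to_le cv); near=> n => /=; rewrite cumulE// lee_fin leNgt.
apply/negP => /(VaR_le mZ q0); apply/negP; rewrite -ltNge.
by rewrite ltrBlDr ltrDl invr_gt0.
Unshelve. all: by end_near. Qed.

(** With no atom at the quantile, the bound from right continuity and the bound on the strict
    sublevel set meet. *)
Lemma cumul_VaR q Z : measurable_fun setT Z -> cont_distributed P Z ->
  0 < q < 1 -> cumul Z (VaR P q Z) = q.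
Proof.
move=> mZ cZ /andP[q0 q1]; apply/eqP; rewrite eq_le cumul_VaR_ge// andbT.
apply: le_trans (probability_lt_VaR mZ q0); rewrite /cumul.
set v := VaR P q Z.
have mlt : measurable [set w | Z w < v].
  rewrite set_ltE; apply: bigcup_measurable => n _.
  exact: measurable_set_le.
have meq : measurable [set w | Z w = v].
  by have := measurable_preimage mZ (measurable_set1 v).
rewrite -lee_fin !fineK ?fin_num_measure//; last exact: measurable_set_le.
rewrite -[leRHS]adde0 -(cZ v); apply: le_trans (measureU2 _ _ _) => //.
apply: le_measure; rewrite ?inE//; first exact: measurable_set_le.
- exact: measurableU.
- by move=> w /=; rewrite le_eqVlt => /orP[/eqP|]; [right|left].
Qed.

End Distribution.

(** * Invariance under equality in distribution *)

Section EqDist.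
Context {d : measure_display} {T : measurableType d} {R : realType}.
Variable P : probability T R.
Implicit Types (X Y Z : T -> R) (q : R).

Lemma eq_dist_sym X Y : eq_dist P X Y -> eq_dist P Y X.
Proof. by move=> XY B mB; rewrite XY. Qed.

Lemma eq_dist_trans X Y Z : eq_dist P X Y -> eq_dist P Y Z -> eq_dist P X Z.
Proof. by move=> XY YZ B mB; rewrite XY// YZ. Qed.

Lemma ae_eq_dist X Y : measurable_fun setT X -> measurable_fun setT Y ->
  {ae P, forall w, X w = Y w} -> eq_dist P X Y.
Proof.
move=> mX mY [N [mN N0 XYN]] B mB.
have mXB := measurable_preimage mX mB; have mYB := measurable_preimage mY mB.
have eqN U V : (forall w, ~ N w -> U w -> V w) ->
    measurable U -> measurable V -> (P U <= P V)%E.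
  move=> UV mU mV; rewrite -[leRHS]adde0 -N0.
  apply: le_trans (measureU2 _ mV mN) => //.
  apply: le_measure; rewrite ?inE//; first exact: measurableU.
  by move=> w Uw; have [Nw|nNw] := pselect (N w); [right|left; exact: UV].
have XY w : ~ N w -> X w = Y w by apply: contra_notP => nXY; exact: XYN.
by apply/eqP; rewrite eq_le !eqN// => w /XY; rewrite /preimage/= => ->.
Qed.

Lemma eq_dist_cont X Y : eq_dist P X Y -> cont_distributed P Y ->
  cont_distributed P X.
Proof. by move=> XY cY x; rewrite -(cY x); exact: XY (measurable_set1 x). Qed.

Lemma eq_dist_VaR X Y q : eq_dist P X Y -> VaR P q X = VaR P q Y.
Proof.
move=> XY; congr inf; apply/seteqP.
by split=> x /=; rewrite (set_leE X) (set_leE Y) XY.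
Qed.

Lemma eq_dist_ES X Y q : eq_dist P X Y -> ES P q X = ES P q Y.
Proof.
move=> XY; congr (_ * _)%E; apply: eq_integral => r _.
by rewrite (eq_dist_VaR _ XY).
Qed.

Lemma ae_eq_distD X Y X0 Y0 : measurable_fun setT X -> measurable_fun setT Y ->
  versions P X Y X0 Y0 -> eq_dist P (X0 \+ Y0) (X \+ Y).
Proof.
move=> mX mY [mX0 mY0 XX0 YY0]; apply: ae_eq_dist; try exact: measurable_funD.
by apply: (filterS2 _ _ XX0 YY0) => w /= -> ->.
Qed.

End EqDist.

(** * Tail events and the VaR aggregation bound *)

Section Tail.
Context {d : measure_display} {T : measurableType d} {R : realType}.
Variable P : probability T R.
Implicit Types (X Y Z : T -> R) (p : R).

Lemma not_AsetP p X w : ~ Aset P p X w <-> X w <= VaR P p X.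
Proof.
by rewrite /Aset/=; split=> [/negP|]; [rewrite -leNgt|rewrite leNgt => /negP]. Qed.

Lemma AsetC p X : ~` Aset P p X = [set w | X w <= VaR P p X].
Proof.
by apply/seteqP; split=> w; have [] := not_AsetP p X w.
Qed.

Lemma measurable_Aset p X : measurable_fun setT X -> measurable (Aset P p X).
Proof. exact: measurable_set_gt. Qed.

Lemma probability_Aset p X : measurable_fun setT X -> cont_distributed P X ->
  0 < p < 1 -> fine (P (Aset P p X)) = 1 - p.
Proof.
move=> mX cX p01; rewrite -[Aset _ _ _]setCK AsetC fine_probability_setC.
  by rewrite -[fine _]/(cumul P X _) cumul_VaR.
exact: measurable_set_le.
Qed.

Lemma eq_dist_gt X Y x : eq_dist P X Y ->
  P [set w | x < X w] = P [set w | x < Y w].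
Proof.
have gtE Z : [set w | x < Z w] = Z @^-1` `]x, +oo[.
  by apply/seteqP; split=> w /=; rewrite in_itv/= andbT.
by move=> XY; rewrite !gtE XY.
Qed.

(** A sum above [a + b] forces one summand above its own threshold, so a union bound applies. Only
    marginal laws enter, which makes the bound uniform over couplings. *)
Lemma VaR_add_le p X Y X' Y' a b :
  measurable_fun setT X' -> measurable_fun setT Y' ->
  measurable_fun setT X -> measurable_fun setT Y ->
  0 < p -> eq_dist P X' X -> eq_dist P Y' Y ->
  fine (P [set w | a < X w]) + fine (P [set w | b < Y w]) < 1 - p ->
  VaR P p (X' \+ Y') <= a + b.
Proof.
move=> mX' mY' mX mY p0 XX' YY' ab.
have mD : measurable_fun setT (X' \+ Y') by exact: measurable_funD.
apply: VaR_le => //.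
have : fine (P (~` [set w | (X' \+ Y') w <= a + b])) < 1 - p.
  apply: le_lt_trans ab.
  rewrite -(eq_dist_gt a XX') -(eq_dist_gt b YY').
  apply: le_trans (fine_measureU2 _ _ _); try exact: measurable_set_gt.
  apply: le_fine_measure.
  - by apply: measurableC; exact: measurable_set_le.
  - by apply: measurableU; exact: measurable_set_gt.
  move=> w /= /negP; rewrite -ltNge => abw.
  have [|Xa] := ltP a (X' w); first by left.
  by right; rewrite -(ltrD2l a) (lt_le_trans abw)// lerD2r.
by rewrite fine_probability_setC ?ltrD2l ?ltrN2//; exact: measurable_set_le.
Qed.

(** For each [e > 0], thresholds with [a + b = v + e] are found whose exceedance events are
    disjoint, lie in the tail event and leave a part of positive probability uncovered, as
    [VaR_add_le] requires. *)
Lemma VaR_aggregation_le p X Y X' Y' :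
  measurable_fun setT X -> measurable_fun setT Y ->
  cont_distributed P X -> 0 < p < 1 ->
  wcomono_P P p X Y -> wantimono_Q P p X Y ->
  measurable_fun setT X' -> measurable_fun setT Y' ->
  eq_dist P X' X -> eq_dist P Y' Y ->
  VaR P p (X' \+ Y') <= VaR P p (X \+ Y).
Proof.
move=> mX mY cX p01 comono anti mX' mY' XX' YY'.
have /andP[p0 p1] := p01.
have mS : measurable_fun setT (X \+ Y) by exact: measurable_funD.
set v := VaR P p (X \+ Y); set A := Aset P p X; set x := VaR P p X.
have mA : measurable A by exact: measurable_Aset.
(* Half of [e] raises the level of the sum to [v + h]; the other half is the width of a slice. *)
apply/ler_addgt0Pr => e e0; pose h := e / 2.
have h0 : 0 < h by rewrite divr_gt0.
pose E := A `&` [set w | (X \+ Y) w <= v + h].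
have mE : measurable E by apply: measurableI => //; exact: measurable_set_le.
(* The sum is at most [v + h] with probability above [p], while the complement of [A] has
   probability [p] only. *)
have PE : (0 < P E)%E.
  have Fp : p < cumul P (X \+ Y) (v + h) by apply: cumul_gt; rewrite // ltrDl.
  rewrite -[P E]fineK ?fin_num_measure// lte_fin -(ltrD2r p) add0r.
  apply: lt_le_trans Fp _.
  apply: (@le_trans _ _ (fine (P E) + cumul P X x)); last by rewrite cumul_VaR.
  apply: le_trans (fine_measureU2 _ _ _) => //; last exact: measurable_set_le.
  apply: le_fine_measure; first exact: measurable_set_le.
    by apply: measurableU => //; exact: measurable_set_le.
  move=> w /= vw; have [Aw|nAw] := pselect (A w); first by left.
  by right; apply/not_AsetP.
(* On a thin enough slice of [X], antimonotonicity separates the events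
   [{a < X}] and [{b < Y}] inside the tail event and from the slice. *)
pose slice (k : nat) := E `&` [set w | x + h * k%:R <= X w <= x + h * k.+1%:R].
have mslice k : measurable (slice k).
  apply: measurableI => //.
  rewrite (_ : mkset _ = X @^-1` `[x + h * k%:R, x + h * k.+1%:R]).
    exact: measurable_preimage.
  by apply/seteqP; split=> w /=; rewrite in_itv.
(* Countably many slices cover [E], so they cannot all be null. *)
have [k Pk] : exists k, (0 < P (slice k))%E.
  apply: contrapT => /forallNP sl0.
  have : P.-negligible (\bigcup_k slice k).
    apply: negligible_bigcup => k; apply/negligibleP => //.
    by apply/eqP; rewrite -measure_le0 leNgt; apply/negP/sl0.
  have EU : E `<=` \bigcup_k slice k.
    move=> w Ew; have [Aw _] := Ew.
    have Xx : 0 <= (X w - x) / h.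
      by rewrite divr_ge0 ?(ltW h0)// subr_ge0 ltW.
    have /andP[kl ku] := Num.Theory.truncn_itv Xx.
    exists (Num.Def.truncn ((X w - x) / h)) => //; split=> //=.
    rewrite -lerBrDl mulrC -ler_pdivlMr// kl/=.
    by rewrite -lerBlDl mulrC -ler_pdivrMr// ltW.
  move=> /(negligibleS EU) /(measure_negligible mE) E0.
  by rewrite E0 ltxx in PE.
(* [a] is the right end of the slice; subtracting its left end from [v + h] bounds [Y] there. *)
pose a := x + h * k.+1%:R; pose b := v + h - (x + h * k%:R).
have sab w : slice k w -> X w <= a /\ Y w <= b.
  move=> [[_ /= XYv] /= /andP[lX uX]]; split=> //.
  rewrite lerBrDr; apply: le_trans XYv.
  by rewrite addrC lerD2r.
have [w0 sw0] : slice k !=set0.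
  by apply/set0P; apply: contraTneq Pk => ->; rewrite measure0 ltxx.
have Aw0 : A w0 by case: sw0 => -[].
have [Xw0 Yw0] := sab _ sw0.
have -> : v + e = a + b by rewrite /a /b -natr1 /h; lra.
apply: (@VaR_add_le p X Y) => //.
rewrite -(probability_Aset mX cX p01).
have mXa := measurable_set_gt a mX; have mYb := measurable_set_gt b mY.
rewrite -fine_measureU//; last first.
  rewrite disj_set2E; apply/eqP; rewrite -subset0 => w /= [aX bY].
  have Aw : A w by rewrite /A/Aset/=; apply: lt_trans (lt_le_trans Aw0 Xw0) aX.
  have := anti _ _ Aw Aw0; apply/negP; rewrite -ltNge mulr_gt0// subr_gt0.
    exact: le_lt_trans aX.
  exact: le_lt_trans bY.
rewrite -subr_gt0.
have Pk' : 0 < fine (P (slice k)).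
  by rewrite fine_gt0// Pk ltey_eq fin_num_measure.
apply: lt_le_trans Pk' _; rewrite lerBrDr -fine_measureU//.
- apply: le_fine_measure => //.
    by apply: measurableU => //; exact: measurableU.
  move=> w [[[]//]|[aX|bY]].
    by rewrite /Aset/=; apply: lt_trans (lt_le_trans Aw0 Xw0) aX.
  (* A point off the tail with [Y] above [b] would beat [w0] in [Y] while lying below it in [X]. *)
  apply: contrapT => nAw; have := comono _ _ Aw0 nAw.
  apply/negP; rewrite -ltNge nmulr_llt0 ?subr_gt0 ?subr_lt0.
    by move/not_AsetP : nAw => /le_lt_trans; apply.
  exact: le_lt_trans bY.
- exact: measurableU.
- rewrite disj_set2E; apply/eqP; rewrite -subset0 => w /= [/sab[aX bY]] [].
    by rewrite ltNge aX.
  by rewrite ltNge bY.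
Qed.

End Tail.

(** * The quantile transform between two probability spaces *)

Section QuantileTransform.
Context {d : measure_display} {T : measurableType d} {R : realType}.
Variable P : probability T R.
Context {d' : measure_display} {T' : measurableType d'}.
Variable Q : probability T' R.

(** The rays []x, +oo[] form a generating pi-system on which [cumul] fixes the law. Two spaces are
    allowed because one side may be the real line under the uniform law. *)
Lemma cumul_inj (X : T -> R) (Y : T' -> R) :
  measurable_fun setT X -> measurable_fun setT Y -> cumul P X =1 cumul Q Y ->
  forall B, measurable B -> P (X @^-1` B) = Q (Y @^-1` B).
Proof.
move=> mX mY XY B mB.
pose PX : probability _ R := distribution P (mfun_Sub (mem_set mX)).
pose QY : probability _ R := distribution Q (mfun_Sub (mem_set mY)).
have gtE d1 (T1 : measurableType d1) (P1 : probability T1 R) (Z : T1 -> R) x :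
    measurable_fun setT Z ->
    P1 (Z @^-1` `]x, +oo[) = (1 - cumul P1 Z x)%:E.
  move=> mZ; rewrite (_ : Z @^-1` _ = ~` [set w | Z w <= x]).
    by rewrite probability_setC ?cumulE//; exact: measurable_set_le.
  by apply/seteqP; split=> w /=; rewrite in_itv/= andbT ltNge => /negP.
apply: (measure_unique (@RGenOInfty.G R) (fun n => `](- n%:R), +oo[%classic)
  _ _ _ _ PX QY) => //.
- exact: RGenOInfty.measurableE.
- move=> _ _ [x ->] [y ->]; exists (Num.max x y).
  by apply/seteqP; split=> z /=; rewrite !in_itv/= !andbT gt_max;
    [move=> [-> ->]|move/andP].
- by move=> n; exists (- n%:R).
- rewrite -subTset => x _; exists (Num.Def.truncn (`|x|)).+1 => //=.
  rewrite in_itv/= andbT ltrNl (le_lt_trans (ler_norm _))// normrN.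
  exact: truncnS_gt.
- move=> _ [x ->]; apply: etrans (gtE _ _ P X x mX) _.
  by rewrite XY; exact/esym/gtE.
- by move=> n; rewrite -ge0_fin_numE// fin_num_measure.
Qed.

(* [c] replaces the junk values of [VaR P u Z] for [u] outside ]0, 1[. *)
Definition quantile (Z : T -> R) (c u : R) : R :=
  if (0 < u) && (u < 1) then VaR P u Z else c.

(** Monotonicity on []0, 1[] makes the preimages of rays intervals there. *)
Lemma measurable_quantile (Z : T -> R) c : measurable_fun setT Z ->
  measurable_fun setT (quantile Z c).
Proof.
move=> mZ; apply: measurable_fun_if => //.
- by apply: measurable_and; exact: measurable_fun_ltr.
- have mD : measurable
      ([set: R] `&` (fun u : R => (0 < u) && (u < 1)) @^-1` [set true]).
    rewrite setTI (_ : _ @^-1` _ = `]0, 1[%classic); first exact: measurable_itv.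
    by apply/seteqP; split=> u /=; rewrite in_itv.
  apply: (measurability (@RGenCInfty.G R)) => [|/= _ [_] [r] -> <-].
    exact: RGenCInfty.measurableE.
  apply: is_interval_measurable => s t /= [[_ /andP[s0 s1]]].
  rewrite !in_itv/= !andbT => rs [[_ /andP[t0 t1]] rt] u /andP[su ut].
  have u0 : 0 < u := lt_le_trans s0 su; have u1 := le_lt_trans ut t1.
  by split; [rewrite u0 u1|rewrite in_itv/= andbT (le_trans rs)// VaR_homo].
Qed.

(** If the two distribution functions differed at [y], comparing the events [U <= t] and
    [quantile Z c \o U <= y] at their midpoint [t] would give a contradiction. *)
Lemma cumul_quantile (Z : T -> R) (U : T' -> R) c :
  measurable_fun setT Z -> measurable_fun setT U ->
  (forall t, 0 < t < 1 -> cumul Q U t = t) ->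
  cumul P Z =1 cumul Q (quantile Z c \o U).
Proof.
move=> mZ mU Ut y.
have mV : measurable_fun setT (quantile Z c \o U).
  by apply: measurableT_comp => //; exact: measurable_quantile.
(* The hypothesis covers open levels only: a mass [m > 0] at or below 0 would exceed the value
   [m / 2] prescribed at level [m / 2]. *)
have U0 : cumul Q U 0 = 0.
  apply/eqP; rewrite eq_le cumul_ge0 andbT leNgt; apply/negP => U0.
  have U0le1 := cumul_le1 Q 0 mU.
  have : cumul Q U 0 <= cumul Q U (cumul Q U 0 / 2).
    by apply: cumul_homo => //; lra.
  by rewrite (Ut (_ / 2)) => [?|]; [|apply/andP; split]; lra.
have mU1 : measurable [set w | 1 <= U w].
  rewrite (_ : mkset _ = U @^-1` `[1, +oo[); first exact: measurable_preimage.
  by apply/seteqP; split=> w /=; rewrite in_itv/= andbT.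
(* Symmetrically, a mass [u > 0] at or above 1 contradicts the value at [1 - u / 2]. *)
have U1 : fine (Q [set w | 1 <= U w]) = 0.
  set u := fine _; apply/eqP; rewrite eq_le fine_ge0// andbT leNgt.
  apply/negP => u0; have u1 : u <= 1 by exact: fine_probability_le1.
  have : u <= fine (Q (~` [set w | U w <= 1 - u / 2])).
    apply: le_fine_measure => //.
      by apply: measurableC; exact: measurable_set_le.
    by move=> w /= Uw; apply/negP; rewrite -ltNge; lra.
  rewrite fine_probability_setC -/(cumul _ _ _); last exact: measurable_set_le.
  by rewrite (Ut (1 - _)) => [?|]; [|apply/andP; split]; lra.
have [f0 f1] := (cumul_ge0 P Z y, cumul_le1 P y mZ).
have [q0 q1] := (cumul_ge0 Q (quantile Z c \o U) y, cumul_le1 Q y mV).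
apply/eqP; rewrite eq_le; apply/andP; split; rewrite leNgt; apply/negP => qf.
- pose t := (cumul P Z y + cumul Q (quantile Z c \o U) y) / 2.
  have : cumul Q U t <=
    fine (Q ([set w | (quantile Z c \o U) w <= y] `|` [set w | U w <= 0])).
    apply: le_fine_measure; [exact: measurable_set_le| |].
      by apply: measurableU; exact: measurable_set_le.
    move=> w /= Uwt; have [|U0w] := leP (U w) 0; first by right.
    left; rewrite /quantile U0w (le_lt_trans Uwt)/=; last by rewrite /t; lra.
    by apply: VaR_le => //; apply: le_lt_trans Uwt _; rewrite /t; lra.
  rewrite (Ut t); last by rewrite /t; apply/andP; split; lra.
  move=> /le_trans /(_ (fine_measureU2 _ _ _)).
  move=> /(_ (measurable_set_le _ mV) (measurable_set_le _ mU)).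
  by rewrite -/(cumul _ _ _) -/(cumul _ _ _) U0 addr0 /t => ?; lra.
- pose t := (cumul P Z y + cumul Q (quantile Z c \o U) y) / 2.
  have : cumul Q (quantile Z c \o U) y <=
    fine (Q ([set w | U w <= t] `|` [set w | 1 <= U w])).
    apply: le_fine_measure; [exact: measurable_set_le| |].
      by apply: measurableU => //; exact: measurable_set_le.
    move=> w /= Vy; have [|Uw1] := leP 1 (U w); first by right.
    left; have [U0w|U0w] := leP (U w) 0; first by rewrite /t; lra.
    move: Vy; rewrite /quantile U0w Uw1/= => /(cumul_homo P mZ).
    by have := cumul_VaR_ge P mZ Uw1; rewrite /t; lra.
  move=> /le_trans /(_ (fine_measureU2 _ _ _)).
  move=> /(_ (measurable_set_le _ mU) mU1).
  by rewrite U1 addr0 -/(cumul _ _ _) (Ut t) => [|];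
    rewrite /t => *; [|apply/andP; split]; lra.
Qed.

End QuantileTransform.

(** * Expected excess over a threshold *)

Section Excess.
Context {d : measure_display} {T : measurableType d} {R : realType}.
Variable P : probability T R.

(** The stop-loss transform of [Z] as a real number; [excessE] identifies it with the extended
    integral for integrable [Z]. *)
Definition excess (Z : T -> R) (c : R) : R :=
  (\int[P]_w Num.max (Z w - c) 0)%R.

Lemma integrable_excess (Z : T -> R) c : P.-integrable setT (EFin \o Z) ->
  P.-integrable setT (fun w => (Num.max (Z w - c) 0)%:E).
Proof.
move=> iZ; apply: (@integrable_funrpos _ _ _ P setT (fun w => Z w - c)) => //.
have := integrableB measurableT iZ
  (finite_measure_integrable_cst P c measurableT).
by apply: eq_integrable.
Qed.

Lemma excessE (Z : T -> R) c : P.-integrable setT (EFin \o Z) ->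
  (\int[P]_w (Num.max (Z w - c) 0)%:E)%E = (excess Z c)%:E.
Proof.
move=> iZ; rewrite /excess /Rintegral fineK//.
by apply: integrable_fin_num => //; exact: integrable_excess.
Qed.

End Excess.

(** * Law invariance of the expected excess *)

Section ExcessTransfer.
Context {d : measure_display} {T : measurableType d} {R : realType}.
Variable P : probability T R.
Context {d' : measure_display} {T' : measurableType d'}.
Variable Q : probability T' R.

Lemma integral_excess_law (X : T -> R) (Y : T' -> R) c :
  measurable_fun setT X -> measurable_fun setT Y ->
  (forall B, measurable B -> P (X @^-1` B) = Q (Y @^-1` B)) ->
  (\int[P]_w (Num.max (X w - c) 0)%:E = \int[Q]_w (Num.max (Y w - c) 0)%:E)%E.
Proof.
move=> mX mY XY.
pose f (y : R) := (Num.max (y - c) 0)%:E.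
have mf : measurable_fun setT f.
  by apply/measurable_EFinP/measurable_maxr => //; exact: measurable_funB.
have f0 y : (0 <= f y)%E by rewrite lee_fin le_max lexx orbT.
transitivity (\int[pushforward P X]_y f y)%E.
  by rewrite ge0_integral_pushforward// => y _.
transitivity (\int[pushforward Q Y]_y f y)%E; last first.
  by rewrite ge0_integral_pushforward// => y _.
by apply: eq_measure_integral => B mB _; exact: XY.
Qed.

End ExcessTransfer.

(** * Expected shortfall through the excess over the quantile *)

Section ExpectedShortfall.
Context {d : measure_display} {T : measurableType d} {R : realType}.
Variable P : probability T R.

Lemma cumul_uniform (t : R) : 0 < t < 1 ->
  cumul (uniform_prob (@ltr01 R)) (idfun : measurableTypeR R -> R) t = t.
Proof.
move=> /andP[t0 t1]; transitivity (fine (\int[lebesgue_measure]_(x in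
  [set x : R | (x <= t)%R]) (uniform_pdf 0 1 x)%:E)%E); first by [].
rewrite integral_uniform_pdf.
rewrite (_ : _ `&` _ = `[0, t]%classic); last first.
  apply/seteqP; split=> x /=; rewrite !in_itv/=.
    by move=> [-> /andP[-> _]].
  by move=> /andP[-> xt]; rewrite xt (le_trans xt)// ltW.
rewrite (eq_integral (fun=> 1%:E)); last first.
  move=> x; rewrite inE/= in_itv/= => /andP[x0 xt].
  by rewrite /uniform_pdf x0 (le_trans xt (ltW t1))/= subr0 invr1.
by rewrite integral_cst//= lebesgue_measure_itv/= lte_fin t0 sube0 mul1e.
Qed.

(** Under a uniform level [u], [VaR P u Z] has the law of [Z]. By monotonicity its excess over [v]
    vanishes for [u <= p] and equals [VaR P u Z - v] beyond, so the integral over the tail levels is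
    [(1 - p) * v] plus the full expected excess. *)
Lemma ES_excess p (Z : T -> R) : P.-integrable setT (EFin \o Z) -> 0 < p < 1 ->
  ES P p Z = ((1 - p)^-1 * ((1 - p) * VaR P p Z + excess P Z (VaR P p Z)))%:E.
Proof.
move=> iZ /andP[p0 p1]; rewrite /ES EFinM; congr (_ * _)%E.
set v := VaR P p Z.
have mZ : measurable_fun setT Z by apply/measurable_EFinP; case/integrableP: iZ.
(* The default [v] makes [h] vanish outside []0, 1[], so the endpoints of the uniform support
   contribute nothing. *)
pose h (u : R) := (Num.max (quantile P Z v u - v) 0)%:E.
have mh : measurable_fun setT h.
  apply/measurable_EFinP/measurable_maxr => //.
  by apply: measurable_funB => //; exact: measurable_quantile.
have h0 u : (0 <= h u)%E by rewrite lee_fin le_max lexx orbT.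
have mI : measurable (`]p, 1[%classic : set R) by exact: measurable_itv.
have hp : (\int[@lebesgue_measure R]_(u in `]p, 1%R[) h u =
  (excess P Z v)%:E)%E.
  rewrite -excessE//.
  have mid : measurable_fun setT (idfun : measurableTypeR R -> R).
    exact: measurable_id.
  have law : cumul P Z =1 cumul (uniform_prob (@ltr01 R)) (quantile P Z v).
    exact: (cumul_quantile P v mZ mid (@cumul_uniform)).
  have mq : measurable_fun (setT : set (measurableTypeR R)) (quantile P Z v).
    exact: measurable_quantile.
  rewrite (integral_excess_law v mZ mq (cumul_inj mZ mq law)).
  rewrite integral_uniform// subr0 invr1 mul1e.
  rewrite integral_mkcond [RHS]integral_mkcond; apply: eq_integral => u _.
  rewrite !patchE !mem_setE !in_itv/= /h /quantile.
  have [u0|u0] := ltP 0 u; last first.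
    by rewrite subrr maxxx !if_same.
  rewrite (ltW u0)/=; have [u1|u1] := ltP u 1; last first.
    by rewrite andbF subrr maxxx if_same.
  rewrite (ltW u1) andbT/=; have [//|up] := ltP p u.
  by rewrite max_r// subr_le0 VaR_homo.
have ih : (@lebesgue_measure R).-integrable `]p, 1[%classic h.
  apply/integrableP; split; first exact: measurable_funTS.
  by under eq_integral do rewrite gee0_abs//; rewrite hp ltry.
transitivity (\int[@lebesgue_measure R]_(u in `]p, 1%R[) (v%:E + h u))%E.
  apply: eq_integral => u; rewrite inE/= in_itv/= => /andP[pu u1].
  rewrite /h /quantile (lt_trans p0 pu) u1/= max_l ?subr_ge0 ?VaR_homo ?ltW//.
  by rewrite -EFinD addrC subrK.
rewrite integralD//; last first.
  apply/integrableP; split; first exact: measurable_cst.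
  by rewrite integral_cst//= lebesgue_measure_itv/= lte_fin p1 -EFinD -EFinM ltry.
rewrite hp integral_cst//= lebesgue_measure_itv/= lte_fin p1.
by rewrite EFinD EFinM muleC EFinB.
Qed.

End ExpectedShortfall.

(** * The Rockafellar-Uryasev objective *)

Section RockafellarUryasev.
Context {d : measure_display} {T : measurableType d} {R : realType}.
Variable P : probability T R.
Implicit Types (X Y Z : T -> R) (p : R).

Definition ru p Z c : R := (1 - p) * c + excess P Z c.

Lemma integrable_measurable Z : P.-integrable setT (EFin \o Z) ->
  measurable_fun setT Z.
Proof. by case/integrableP => /measurable_EFinP. Qed.

Lemma integrable_add X Y : P.-integrable setT (EFin \o X) ->
  P.-integrable setT (EFin \o Y) -> P.-integrable setT (EFin \o (X \+ Y)).
Proof. by move=> iX iY; have := integrableD measurableT iX iY; exact: eq_integrable. Qed.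

Lemma ES_le p Z Z' : P.-integrable setT (EFin \o Z) ->
  P.-integrable setT (EFin \o Z') -> 0 < p < 1 ->
  (ES P p Z <= ES P p Z')%E = (ru p Z (VaR P p Z) <= ru p Z' (VaR P p Z')).
Proof.
move=> iZ iZ' p01; rewrite !ES_excess// lee_fin ler_pM2l// invr_gt0 subr_gt0.
by case/andP: p01.
Qed.

(** Integrates a pointwise subgradient inequality, so that only the probability of [A] remains; it
    serves both minimality lemmas below. *)
Lemma excess_le_indic Z a b k (A : set T) : P.-integrable setT (EFin \o Z) ->
  measurable A ->
  (forall w, Num.max (Z w - a) 0 <= Num.max (Z w - b) 0 + k * \1_A w) ->
  excess P Z a <= excess P Z b + k * fine (P A).
Proof.
move=> iZ mA ab.
have iA : P.-integrable setT (EFin \o (\1_A : T -> R)).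
  apply: (le_integrable measurableT _ _ (finite_measure_integrable_cst P 1 measurableT)).
    exact/measurable_EFinP/measurable_indic.
  move=> w _ /=; rewrite lee_fin indicE normr1 ger0_norm//.
  by case: (_ \in _).
have ikA : P.-integrable setT (EFin \o (fun w => k * \1_A w)).
  have := integrableZl measurableT k iA; exact: eq_integrable.
have -> : fine (P A) = (\int[P]_w (\1_A w : R))%R.
  by rewrite /Rintegral integral_indic// setIT.
rewrite -RintegralZl// -RintegralD//; last exact: integrable_excess.
apply: le_Rintegral => //; first exact: integrable_excess.
have := integrableD measurableT (integrable_excess b iZ) ikA; exact: eq_integrable.
Qed.

(** The law of [Z] may have an atom at [v], so the closed tail, of mass at least [1 - p], gives the
    subgradient on the left, and the open tail, of mass at most [1 - p], on the right. *)
Lemma VaR_min_ru p Z c : P.-integrable setT (EFin \o Z) -> 0 < p < 1 ->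
  ru p Z (VaR P p Z) <= ru p Z c.
Proof.
move=> iZ /andP[p0 p1]; have mZ := integrable_measurable iZ.
rewrite /ru; set v := VaR P p Z.
have [cv|vc] := leP c v.
- pose A := ~` [set w | Z w < v].
  have mlt : measurable [set w | Z w < v].
    by rewrite set_ltE; apply: bigcup_measurable => n _; exact: measurable_set_le.
  have PA : 1 - p <= fine (P A).
    by rewrite fine_probability_setC// lerD2l lerN2; exact: probability_lt_VaR.
  have : excess P Z v <= excess P Z c + (c - v) * fine (P A).
    apply: excess_le_indic => //; first exact: measurableC.
    move=> w; rewrite indicE.
    have [vZ|Zv] := leP v (Z w).
      rewrite mem_set/=; last by apply/negP; rewrite -leNgt.
      by rewrite !max_l; lra.
    rewrite memNset/=; last by move=> /(_ Zv).
    by rewrite mulr0 addr0 max_r ?le_max ?lexx ?orbT//; lra.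
  have : (c - v) * fine (P A) <= (c - v) * (1 - p).
    by apply: ler_wnM2l => //; lra.
  by nra.
- have : excess P Z v <= excess P Z c + (c - v) * fine (P [set w | v < Z w]).
    apply: excess_le_indic => //; first exact: measurable_set_gt.
    move=> w; rewrite indicE; have [vZ|Zv] := ltP v (Z w).
      rewrite mem_set//= mulr1 max_l; last by lra.
      by rewrite -lerBlDr le_max; apply/orP; left; lra.
    rewrite memNset/=; last by apply/negP; rewrite -leNgt.
    by rewrite mulr0 addr0 max_r ?le_max ?lexx ?orbT//; lra.
  have PA : fine (P [set w | v < Z w]) <= 1 - p.
    rewrite (_ : mkset _ = ~` [set w | Z w <= v]); last first.
      by apply/seteqP; split=> w /=; rewrite ltNge => /negP.
    rewrite fine_probability_setC; last exact: measurable_set_le.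
    by rewrite lerD2l lerN2; exact: cumul_VaR_ge.
  have : (c - v) * fine (P [set w | v < Z w]) <= (c - v) * (1 - p).
    by apply: ler_wpM2l => //; lra.
  by nra.
Qed.

(** The indicator of [A] gives a subgradient at [s], and its mass [1 - p] cancels the linear term
    exactly; hence [s] may differ from the quantile. *)
Lemma tail_threshold_min_ru p Z (A : set T) s c :
  P.-integrable setT (EFin \o Z) -> measurable A -> fine (P A) = 1 - p ->
  (forall w, A w -> s <= Z w) -> (forall w, ~ A w -> Z w <= s) ->
  ru p Z s <= ru p Z c.
Proof.
move=> iZ mA PA sZ Zs; rewrite /ru.
suff : excess P Z s <= excess P Z c + (c - s) * fine (P A) by rewrite PA; lra.
apply: excess_le_indic => // w; rewrite indicE.
have [Aw|nAw] := pselect (A w).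
  rewrite mem_set//= mulr1 max_l ?subr_ge0 ?sZ//.
  by rewrite -lerBlDr le_max; apply/orP; left; lra.
rewrite memNset//= mulr0 addr0 max_r ?subr_le0 ?Zs//.
by rewrite le_max lexx orbT.
Qed.

Lemma le_maxD (x y : R) :
  Num.max (x + y) 0 <= Num.max x 0 + Num.max y 0.
Proof.
by rewrite ge_max addr_ge0 ?le_max ?lexx ?orbT// lerD// le_max lexx.
Qed.

Lemma integrable_excessD X Y a b : P.-integrable setT (EFin \o X) ->
  P.-integrable setT (EFin \o Y) ->
  P.-integrable setT
    (EFin \o (fun w => Num.max (X w - a) 0 + Num.max (Y w - b) 0)).
Proof.
move=> iX iY.
have := integrableD measurableT (integrable_excess a iX) (integrable_excess b iY).
exact: eq_integrable.
Qed.

Lemma ru_add_le p X Y a b : P.-integrable setT (EFin \o X) ->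
  P.-integrable setT (EFin \o Y) ->
  ru p (X \+ Y) (a + b) <= ru p X a + ru p Y b.
Proof.
move=> iX iY; rewrite /ru.
suff : excess P (X \+ Y) (a + b) <= excess P X a + excess P Y b by lra.
rewrite /excess -RintegralD//; try exact: integrable_excess.
apply: le_Rintegral => //.
- by apply: integrable_excess; exact: integrable_add.
- exact: integrable_excessD.
- by move=> w _; rewrite /= opprD addrACA le_maxD.
Qed.

Lemma ru_add_aligned p X Y a b : P.-integrable setT (EFin \o X) ->
  P.-integrable setT (EFin \o Y) ->
  (forall w, a <= X w /\ b <= Y w \/ X w <= a /\ Y w <= b) ->
  ru p (X \+ Y) (a + b) = ru p X a + ru p Y b.
Proof.
move=> iX iY XY; rewrite /ru.
suff -> : excess P (X \+ Y) (a + b) = excess P X a + excess P Y b by lra.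
rewrite /excess -RintegralD//; try exact: integrable_excess.
apply: eq_Rintegral => w _ /=.
by have [[aX bY]|[aX bY]] := XY w; [rewrite !max_l|rewrite !max_r]; lra.
Qed.

(** The equality case of [ru_add_le]: the gap between the integrands is nonnegative with zero
    integral. *)
Lemma ru_add_ge_ae p X Y a b : P.-integrable setT (EFin \o X) ->
  P.-integrable setT (EFin \o Y) ->
  ru p X a + ru p Y b <= ru p (X \+ Y) (a + b) ->
  {ae P, forall w, Num.max (X w - a) 0 + Num.max (Y w - b) 0 <=
                   Num.max (X w - a + (Y w - b)) 0}.
Proof.
move=> iX iY XY.
pose f w := Num.max (X w - a) 0 + Num.max (Y w - b) 0.
pose g w := Num.max ((X \+ Y) w - (a + b)) 0.
have f_i : P.-integrable setT (EFin \o f) by exact: integrable_excessD.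
have g_i : P.-integrable setT (EFin \o g).
  by apply: integrable_excess; exact: integrable_add.
have gf w : g w <= f w by rewrite /g /f /= opprD addrACA le_maxD.
have fg_i : P.-integrable setT (EFin \o (fun w => f w - g w)).
  have := integrableB measurableT f_i g_i; exact: eq_integrable.
have fg0 : (\int[P]_w (f w - g w) = 0)%R.
  apply/eqP; rewrite eq_le Rintegral_ge0 ?andbT; last first.
    by move=> w _; rewrite subr_ge0.
  rewrite RintegralB// RintegralD//; try exact: integrable_excess.
  move: XY; rewrite /ru -/(excess P X a) -/(excess P Y b).
  by rewrite -/(excess P (X \+ Y) (a + b)); lra.
have : (\int[P]_w `|(f w - g w)%:E| = 0)%E.
  under eq_integral do rewrite gee0_abs ?lee_fin ?subr_ge0//.
  by rewrite -[LHS]fineK ?integrable_fin_num// -/(Rintegral _ _ _) fg0.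
move=> /(ae_eq_integral_abs P measurableT (measurable_int _ fg_i)).
apply: filterS => w /= /(_ Logic.I) [/eqP].
by rewrite subr_eq0 => /eqP; rewrite /f /g /= => ->; rewrite opprD addrACA.
Qed.

(** * Aggregation of expected shortfall *)

Lemma eq_dist_integrable X Y : measurable_fun setT X -> eq_dist P X Y ->
  P.-integrable setT (EFin \o Y) -> P.-integrable setT (EFin \o X).
Proof.
move=> mX XY iY; have mY := integrable_measurable iY.
apply/integrableP; split; first exact/measurable_EFinP.
case/integrableP : iY => _; apply: le_lt_trans.
pose f (y : R) := `|y%:E|%E.
have mf : measurable_fun setT f.
  by apply: measurableT_comp => //; exact: EFin_measurable.
have f0 y : (0 <= f y)%E by exact: abse_ge0.
rewrite le_eqVlt; apply/orP; left; apply/eqP.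
transitivity (\int[pushforward P X]_y f y)%E.
  by rewrite ge0_integral_pushforward// => y _.
transitivity (\int[pushforward P Y]_y f y)%E; last first.
  by rewrite ge0_integral_pushforward// => y _.
by apply: eq_measure_integral => B mB _; exact: XY.
Qed.

Lemma eq_dist_ru p X Y c : measurable_fun setT X -> measurable_fun setT Y ->
  eq_dist P X Y -> ru p X c = ru p Y c.
Proof.
move=> mX mY XY; rewrite /ru /excess /Rintegral.
by rewrite (integral_excess_law c mX mY XY).
Qed.

(** Comonotonicity puts every value of [Y] on the tail event at or above every value off it. A
    threshold [c] for [Y] is therefore aligned with [x], and [x + c] separates the sum on the same
    event. *)
Lemma ES_aggregation_le p X Y X' Y' : 0 < p < 1 ->
  P.-integrable setT (EFin \o X) -> P.-integrable setT (EFin \o Y) ->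
  cont_distributed P X -> wcomono_P P p X Y ->
  measurable_fun setT X' -> measurable_fun setT Y' ->
  eq_dist P X' X -> eq_dist P Y' Y ->
  (ES P p (X' \+ Y')%R <= ES P p (X \+ Y)%R)%E.
Proof.
move=> p01 iX iY cX comono mX' mY' XX' YY'.
have [mX mY] := (integrable_measurable iX, integrable_measurable iY).
have iX' := eq_dist_integrable mX' XX' iX.
have iY' := eq_dist_integrable mY' YY' iY.
rewrite ES_le//; try exact: integrable_add.
set A := Aset P p X; set x := VaR P p X.
have mA : measurable A by exact: measurable_Aset.
have PA : fine (P A) = 1 - p by exact: probability_Aset.
have /andP[p0 p1] := p01.
have [w1 Aw1] : A !=set0.
  by apply/set0P/eqP => A0; move: PA; rewrite A0 measure0/=; lra.
have [w0 Aw0] : ~` A !=set0.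
  apply/set0P/eqP => A0; have := fine_probability_setC P mA.
  by rewrite A0 measure0/= PA; lra.
have YA w w' : A w -> ~ A w' -> Y w' <= Y w.
  move=> Aw nAw'; rewrite leNgt; apply/negP => Yww'.
  (* A strict reversal in [Y] would make the product negative, as [X] is strictly larger on the
     tail. *)
  have := comono _ _ Aw nAw'; apply/negP; rewrite -ltNge nmulr_llt0 ?subr_lt0//.
  by rewrite subr_gt0; move/not_AsetP : nAw' => /le_lt_trans; apply.
(* [w0] makes this set nonempty and [w1] bounds it, so the supremum is genuine; [c] takes the place
   of a quantile of [Y]. *)
pose c := sup (Y @` (~` A)).
have Yc w : A w -> c <= Y w.
  move=> Aw; apply: ge_sup; first by exists (Y w0), w0.
  by move=> _ [w' nAw' <-]; exact: YA.
have cY w : ~ A w -> Y w <= c.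
  move=> nAw; apply: ub_le_sup; last by exists w.
  by exists (Y w1) => _ [w' nAw' <-]; exact: YA.
have Xx w : A w -> x <= X w by exact: ltW.
have xX w : ~ A w -> X w <= x by move/not_AsetP.
(* Move the left side to [x + c], split it into marginal terms, exchange laws, and recombine for [X]
   and [Y], where [x + c] is a minimizer. *)
apply: le_trans (VaR_min_ru (x + c) _ p01) _; first exact: integrable_add.
apply: le_trans (ru_add_le _ _ _ _ _) _ => //.
rewrite (eq_dist_ru _ _ mX' mX XX') (eq_dist_ru _ _ mY' mY YY').
rewrite -ru_add_aligned//; last first.
  by move=> w; have [Aw|nAw] := pselect (A w); [left|right]; split; auto.
apply: (tail_threshold_min_ru _ _ mA) => //; first exact: integrable_add.
- by move=> w Aw; rewrite lerD ?Xx ?Yc.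
- by move=> w nAw; rewrite lerD ?xX ?cY.
Qed.

(** The probability integral transform: [cumul P X (X w)] is at most [t] exactly when [X w] is at
    most the [t]-quantile. *)
Lemma cumul_cumul X t : measurable_fun setT X -> cont_distributed P X ->
  0 < t < 1 -> cumul P (cumul P X \o X) t = t.
Proof.
move=> mX cX t01; rewrite -[RHS](cumul_VaR mX cX t01) /cumul; congr (fine (P _)).
have /andP[t0 t1] := t01.
apply/seteqP; split=> w /=; rewrite -/(cumul P X (X w)) => Xw.
  by rewrite leNgt; apply/negP => /(cumul_gt mX t1); rewrite ltNge Xw.
by rewrite -(cumul_VaR mX cX t01) cumul_homo.
Qed.

(** The alignment obtained is only almost sure, so [X] is kept and [Y] is clipped at [y] to give a
    version aligned everywhere. *)
Lemma ES_aggregation_max_comono p X Y : 0 < p < 1 ->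
  P.-integrable setT (EFin \o X) -> P.-integrable setT (EFin \o Y) ->
  cont_distributed P X ->
  (forall X' Y', measurable_fun setT X' -> measurable_fun setT Y' ->
    eq_dist P X' X -> eq_dist P Y' Y ->
    (ES P p (X' \+ Y')%R <= ES P p (X \+ Y)%R)%E) ->
  exists X0 Y0, versions P X Y X0 Y0 /\ wcomono_P P p X0 Y0.
Proof.
move=> p01 iX iY cX ESmax.
have [mX mY] := (integrable_measurable iX, integrable_measurable iY).
set x := VaR P p X; set y := VaR P p Y.
have mU : measurable_fun setT (cumul P X \o X).
  apply: measurableT_comp => //.
  by apply: nondecreasing_measurable => //; exact: cumul_homo.
(* The default [y] for levels outside []0, 1[] is compatible with both [up] and [down]. *)
pose Y' := quantile P Y y \o (cumul P X \o X).
have mY' : measurable_fun setT Y'.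
  by apply: measurableT_comp => //; exact: measurable_quantile.
have YY' : eq_dist P Y' Y.
  move=> B mB; apply/esym/(cumul_inj mY mY') => //.
  by apply: cumul_quantile => // t; exact: cumul_cumul.
have iY' := eq_dist_integrable mY' YY' iY.
have /andP[p0 p1] := p01.
have Fx : cumul P X x = p by exact: cumul_VaR.
have up w : x < X w -> y <= Y' w.
  move=> /ltW xX; rewrite /Y' /= /quantile; case: ifPn => // /andP[u0 u1].
  by apply: VaR_homo => //; rewrite -Fx cumul_homo.
have down w : X w <= x -> Y' w <= y.
  move=> Xx; rewrite /Y' /= /quantile; case: ifPn => // /andP[u0 u1].
  by apply: VaR_homo => //; rewrite -Fx cumul_homo.
have := ESmax _ _ mX mY' (fun _ _ => erefl) YY'.
rewrite ES_le//; try exact: integrable_add.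
have mA := measurable_Aset P p mX; have PA := probability_Aset mX cX p01.
have low : ru p (X \+ Y') (x + y) <= ru p (X \+ Y') (VaR P p (X \+ Y')).
  apply: (tail_threshold_min_ru _ _ mA) => //; first exact: integrable_add.
    by move=> w xX; rewrite lerD ?up// ltW.
  by move=> w /not_AsetP Xx; rewrite lerD ?down.
(* The objective of [X \+ Y'] at [x + y] is now at most that of [X \+ Y]; alignment and equality of
   laws split the former into marginal terms. *)
move=> /(le_trans low) /le_trans /(_ (VaR_min_ru (x + y) _ p01)).
move=> /(_ (integrable_add iX iY)); rewrite ru_add_aligned//; last first.
  move=> w; have [Xx|xX] := leP (X w) x; [right|left]; split=> //.
  - exact: down.
  - exact: ltW.
  - exact: up.
rewrite (eq_dist_ru _ _ mY' mY YY') => /(ru_add_ge_ae iX iY) XYae.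
(* Where [X w = x], the almost sure inequality leaves [Y w] free although [w] lies off the tail, so
   this null event is removed. *)
have Xxae : {ae P, forall w, X w <> x}.
  exists [set w | X w = x]; split; last by move=> w /= /contrapT.
    exact: (measurable_preimage mX (measurable_set1 x)).
  exact: cX.
pose Y0 w := if x < X w then Num.max (Y w) y else Num.min (Y w) y.
exists X, Y0; split; last first.
  move=> w w'; rewrite /Aset/= -/x => xX /not_AsetP; rewrite -/x => Xx.
  rewrite mulr_ge0 ?subr_ge0//; first exact/ltW/(le_lt_trans Xx).
  rewrite /Y0 xX ltNge Xx/= (@le_trans _ _ y)//.
    by rewrite ge_min lexx orbT.
  by rewrite le_max lexx orbT.
split=> //.
- apply: measurable_fun_if => //.
  + exact: measurable_fun_ltr.
  + by apply: measurable_funTS; apply: measurable_maxr.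
  + by apply: measurable_funTS; apply: measurable_minr.
- by apply: aeW.
(* Strictly opposite signs would make the sum of positive parts exceed the positive part of the sum,
   so clipping almost surely changes nothing. *)
- apply: (filterS2 _ _ XYae Xxae) => w /= XYw Xw; rewrite /Y0.
  case: ltP => [xX|Xx].
    apply: max_l; rewrite leNgt; apply/negP => Yy; move: XYw.
    rewrite (@max_l _ _ (X w - x)) ?(@max_r _ _ (Y w - y)); try lra.
    by apply/negP; rewrite -ltNge gt_max; apply/andP; split; lra.
  have {Xw Xx}Xx : X w < x by rewrite lt_neqAle Xx andbT; exact/eqP.
  apply: min_l; rewrite leNgt; apply/negP => Yy; move: XYw.
  rewrite (@max_r _ _ (X w - x)) ?(@max_l _ _ (Y w - y)); try lra.
  by apply/negP; rewrite -ltNge gt_max; apply/andP; split; lra.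
Qed.

End RockafellarUryasev.

(** Since [(X, Y)] is itself admissible, each maximum is stated as an upper bound over all
    admissible pairs. *)
Theorem theorem3p1 (d : measure_display) (T : measurableType d) (R : realType)
  (P : probability T R) (X Y : T -> R) (p : R) :
  atomless P ->
  measurable_fun setT X -> measurable_fun setT Y ->
  cont_distributed P X -> cont_distributed P Y ->
  P.-integrable setT (EFin \o X) -> P.-integrable setT (EFin \o Y) ->
  0 < p < 1 ->
  ((exists X0 Y0 : T -> R, versions P X Y X0 Y0 /\
      wcomono_P P p X0 Y0 /\ wantimono_Q P p X0 Y0) ->
    forall X' Y' : T -> R, measurable_fun setT X' -> measurable_fun setT Y' ->
      eq_dist P X' X -> eq_dist P Y' Y ->
      VaR P p (X' \+ Y') <= VaR P p (X \+ Y))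
  /\
  ((exists X0 Y0 : T -> R, versions P X Y X0 Y0 /\ wcomono_P P p X0 Y0) <->
    (forall X' Y' : T -> R, measurable_fun setT X' -> measurable_fun setT Y' ->
      eq_dist P X' X -> eq_dist P Y' Y ->
      (ES P p (X' \+ Y')%R <= ES P p (X \+ Y)%R)%E)).
Proof.
move=> _ mX mY cX _ iX iY p01.
(* Versions share the marginal laws, and their sums agree in law too, so the bounds for [X0] and
   [Y0] transfer to [X] and [Y]. *)
have versions_eq_dist X0 Y0 : versions P X Y X0 Y0 ->
    eq_dist P X0 X /\ eq_dist P Y0 Y.
  by case=> mX0 mY0 XX0 YY0; split; exact: ae_eq_dist.
split=> [[X0 [Y0 [ver [comono anti]]]]|].
  move=> X' Y' mX' mY' XX' YY'.
  have [eX eY] := versions_eq_dist _ _ ver; have [mX0 mY0 _ _] := ver.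
  rewrite -(eq_dist_VaR p (ae_eq_distD mX mY ver)).
  apply: VaR_aggregation_le => //; first exact: eq_dist_cont eX cX.
  - exact: eq_dist_trans XX' (eq_dist_sym eX).
  - exact: eq_dist_trans YY' (eq_dist_sym eY).
split=> [[X0 [Y0 [ver comono]]] X' Y' mX' mY' XX' YY'|ESmax].
  have [eX eY] := versions_eq_dist _ _ ver; have [mX0 mY0 _ _] := ver.
  rewrite -(eq_dist_ES p (ae_eq_distD mX mY ver)).
  apply: ES_aggregation_le => //.
  - exact: eq_dist_integrable mX0 eX iX.
  - exact: eq_dist_integrable mY0 eY iY.
  - exact: eq_dist_cont eX cX.
  - exact: eq_dist_trans XX' (eq_dist_sym eX).
  - exact: eq_dist_trans YY' (eq_dist_sym eY).
exact: ES_aggregation_max_comono.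
Qed.
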